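(* Let $V=\{1,\dots,n\}$ with $n\ge1$, let $f:2^V\to\mathbb{R}_+$ be a non-decreasing submodular function with $f(\emptyset)=0$, and let $w\in\mathbb{R}^n$ have all $w_i>0$. Let $\mathcal{F}(f)$ be the family of non-empty sets $S\subseteq V$ that minimize $f(S)/w^{-1}(S)$ over non-empty subsets of $V$. Then a Player 2 strategy $y$ in the game $\Gamma_{\max}(\mathcal{B}(f),w)$ is optimal if and only if it is in the convex hull of $\{y^S: S\in\mathcal{F}(f)\}$.
   Context: For $x\in\mathbb{R}^n$ and $S\subseteq V$, write $x(S)=\sum_{j\in S}x_j$. The base polyhedron is $\mathcal{B}(f)=\{x\in\mathbb{R}^n_+: x(S)\le f(S)\text{ for all }S\subseteq V,\ x(V)=f(V)\}$. Its vertices are the points $x^\sigma$, for permutations $\sigma$ of $V$, given by $x^\sigma_{\sigma(j)}=f(\{\sigma(1),\dots,\sigma(j)\})-f(\{\sigma(1),\dots,\sigma(j-1)\})$, $j=1,\dots,n$. The zero-sum game $\Gamma_{\max}(\mathcal{B}(f),w)$: a pure strategy of Player 1 (the maximizer) is a permutation $\sigma$ of $V$ (equivalently a vertex $x^\sigma$), a pure strategy of Player 2 (the minimizer) is $j\in V$, and the payoff is $P(\sigma,j)=w_jx^\sigma_j$. A mixed strategy of Player 1 is identified with a point $x\in\mathcal{B}(f)$. A (mixed) strategy of Player 2 is identified with a point of the simplex $C=\{\sum_{j=1}^n\theta_jw_je^j:\theta_j\ge0,\ \sum_j\theta_j=1\}$, where $e^j$ is the $j$th coordinate vector. The expected payoff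 is $P(x,y)=x^Ty$. The value is $v=\max_{x\in\mathcal{B}(f)}\min_{j}w_jx_j=\min_{y\in C}\max_{\sigma}(x^\sigma)^Ty$. A Player 2 strategy $y\in C$ is optimal if $\max_{x\in\mathcal{B}(f)}x^Ty=v$. For $S\subseteq V$, $w^{-1}(S)=\sum_{i\in S}1/w_i$. For $S\ne\emptyset$, $y^S=\frac{1}{w^{-1}(S)}\sum_{i\in S}e^i\in C$. *)

(* Defs.v *)
From mathcomp Require Export all_boot all_order all_algebra perm.
From mathcomp Require Export boolp classical_sets reals convex.

Set Implicit Arguments.
Unset Strict Implicit.
Unset Printing Implicit Defensive.

Import Order.TTheory GRing.Theory Num.Theory.
Local Open Scope classical_set_scope.
Local Open Scope ring_scope.

Definition is_max (R : realType) (A : set R) (m : R) : Prop :=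
  A m /\ ubound A m.

Definition is_min (R : realType) (A : set R) (m : R) : Prop :=
  A m /\ lbound A m.

Definition convex_hull (R : realType) (M : lmodType R) (A : set M) : set M :=
  smallest (@convex_set R M) A.

Definition dot (R : realType) (n : nat) (x y : 'rV[R]_n) : R :=
  \sum_(j < n) x 0 j * y 0 j.

Definition nondecreasing_setfun (R : realType) (n : nat)
    (f : {set 'I_n} -> R) : Prop :=
  forall S T : {set 'I_n}, S \subset T -> f S <= f T.

Definition submodular (R : realType) (n : nat) (f : {set 'I_n} -> R) : Prop :=
  forall S T : {set 'I_n}, f (S :|: T) + f (S :&: T) <= f S + f T.

Definition base_polyhedron (R : realType) (n : nat) (f : {set 'I_n} -> R) :
    set 'rV[R]_n :=
  [set x | [/\ forall j, 0 <= x 0 j,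
               forall S : {set 'I_n}, \sum_(j in S) x 0 j <= f S
             & \sum_j x 0 j = f [set: 'I_n]%SET]].

(* The vertex x^sigma; its coordinate k is sigma j for j = sigma^-1 k, and the
   prefixes {sigma 1, ..., sigma j} and {sigma 1, ..., sigma (j - 1)} become
   {sigma i | i <= j} and {sigma i | i < j} with indices starting at 0. *)
Definition vertex (R : realType) (n : nat) (f : {set 'I_n} -> R)
    (sigma : {perm 'I_n}) : 'rV[R]_n :=
  \row_k (let j := (sigma^-1)%g k in
          f [set sigma i | i : 'I_n & (i <= j)%N]%SET
          - f [set sigma i | i : 'I_n & (i < j)%N]%SET).

(* A mixed strategy theta of Player 2 is encoded as \sum_j theta_j w_j e^j, so that
   the expected payoff against x is dot x y. *)
Definition player2_strategy (R : realType) (n : nat) (w : 'rV[R]_n) :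
    set 'rV[R]_n :=
  [set y | exists theta : 'I_n -> R,
     [/\ forall j, 0 <= theta j,
         \sum_j theta j = 1
       & y = \sum_j (theta j * w 0 j) *: delta_mx 0 j]].

(* v is the value of the game: the max-min of Player 1, who mixes over the base
   polyhedron, and the min-max of Player 2 both exist and equal v. *)
Definition game_value (R : realType) (n : nat) (f : {set 'I_n} -> R)
    (w : 'rV[R]_n) (v : R) : Prop :=
  is_max [set m | exists2 x, base_polyhedron f x &
                  is_min (range (fun j : 'I_n => w 0 j * x 0 j)) m] v
  /\
  is_min [set m | exists2 y, player2_strategy w y &
                  is_max (range (fun sigma : {perm 'I_n} =>
                                   dot (vertex f sigma) y)) m] v.

(* Only meaningful for y in player2_strategy w. *)
Definition optimal2 (R : realType) (n : nat) (f : {set 'I_n} -> R)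
    (w y : 'rV[R]_n) : Prop :=
  exists2 v, game_value f w v &
             is_max [set dot x y | x in base_polyhedron f] v.

Definition winv (R : realType) (n : nat) (w : 'rV[R]_n) (S : {set 'I_n}) : R :=
  \sum_(i in S) (w 0 i)^-1.

(* The point y^S, meant for nonempty S. *)
Definition ypoint (R : realType) (n : nat) (w : 'rV[R]_n) (S : {set 'I_n}) :
    'rV[R]_n :=
  (winv w S)^-1 *: \sum_(i in S) delta_mx 0 i.

Definition min_family (R : realType) (n : nat) (f : {set 'I_n} -> R)
    (w : 'rV[R]_n) : set {set 'I_n} :=
  [set S | S != finset.set0 /\
           forall T : {set 'I_n}, T != finset.set0 ->
             f S / winv w S <= f T / winv w T].

(* Main.v *)
Require Import Defs.
From mathcomp Require Import interval_inference ring lra.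
Import Order.TTheory GRing.Theory Num.Theory.
Local Open Scope classical_set_scope.
Local Open Scope ring_scope.

(** Every y >= 0 is a nonnegative combination of indicator vectors of a chain:
    if sigma sorts the coordinates of y decreasingly, then
    y = sum_k lam_k 1_(S_k), where S_k is the set of the k + 1 largest
    coordinates and lam_k >= 0 is the k-th gap in the sorted list.  Summation by
    parts shows that the payoff of the greedy vertex x^sigma against y is the
    corresponding combination sum_k lam_k f(S_k), the Lovasz extension of f at y
    (lemma [chain_decomposition]).

    Membership of y in the simplex of Player 2 means that
    sum_k lam_k w^-1(S_k) = 1.  Hence mu_k = lam_k w^-1(S_k) are convex weights
    with y = sum_k mu_k y^(S_k), and the payoff of x^sigma against y is the
    average of the ratios f(S_k) / w^-1(S_k) with these weights (lemma
    [chain_weights]).  Such an average is at least the minimal ratio v, and it is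
    at most v only if every S_k of positive weight is itself a minimizer, in
    which case y lies in the convex hull of the points y^S for minimizers S.
    Conversely, x . y^S = x(S) / w^-1(S) <= f(S) / w^-1(S) = v for each x in the
    base polyhedron and each minimizer S, and the half-space x . y <= v is convex,
    so no point of the hull concedes more than v.

    It remains to see that v is the value of the game (lemma
    [min_ratio_is_value]).  On Player 2's side this follows from the two bounds
    above.  On Player 1's side, the vector (v / w_j)_j satisfies all the
    inequalities x(S) <= f(S), and by submodularity it can be raised to a point
    of the base polyhedron (lemma [base_extension]), which guarantees v. *)

Set Implicit Arguments.
Unset Strict Implicit.

(** * Greedy vertices and chains of prefixes *)

Lemma sum_indicator {R : pzSemiRingType} {I : finType} (S : {set I}) (j : I) :
  \sum_(i in S) (i == j)%:R = (j \in S)%:R :> R.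
Proof.
case: (boolP (j \in S)) => jS.
  rewrite (bigD1 j) //= eqxx big1 ?addr0 // => i /andP[_ /negPf ij].
  by rewrite ij.
by rewrite big1 // => i iS; case: eqVneq => // ij; rewrite -ij iS in jS.
Qed.

Definition chain {n : nat} (sigma : {perm 'I_n}) (k : nat) : {set 'I_n} :=
  [set sigma i | i : 'I_n & (i < k)%N]%SET.

Lemma mem_chain {n : nat} (sigma : {perm 'I_n}) (k : nat) (i : 'I_n) :
  (sigma i \in chain sigma k) = (i < k)%N.
Proof. by rewrite mem_imset ?inE //; exact: perm_inj. Qed.

Lemma chain0 {n : nat} (sigma : {perm 'I_n}) : chain sigma 0 = finset.set0.
Proof.
apply/setP => j; rewrite inE -(permKV sigma j) mem_chain.
by [].
Qed.

Lemma chain_full {n : nat} (sigma : {perm 'I_n}) :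
  chain sigma n = [set: 'I_n]%SET.
Proof. by apply/setP => j; rewrite inE -(permKV sigma j) mem_chain ltn_ord. Qed.

Lemma chain_neq0 {n : nat} (sigma : {perm 'I_n}) (k : 'I_n) :
  chain sigma k.+1 != finset.set0.
Proof. by apply/set0Pn; exists (sigma k); rewrite mem_chain. Qed.

Lemma chainS {n : nat} (sigma : {perm 'I_n}) (k : 'I_n) :
  chain sigma k.+1 = (sigma k |: chain sigma k)%SET.
Proof.
apply/setP => j; rewrite !inE -(permKV sigma j) !mem_chain (inj_eq perm_inj).
by rewrite ltnS leq_eqVlt.
Qed.

Lemma vertex_at {R : realType} {n : nat} (f : {set 'I_n} -> R)
    (sigma : {perm 'I_n}) (k : 'I_n) :
  vertex f sigma 0 (sigma k) = f (chain sigma k.+1) - f (chain sigma k).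
Proof. by rewrite mxE permK. Qed.

Lemma summation_by_parts {R : comPzRingType} (Y F : nat -> R) (n : nat) :
  \sum_(k < n) Y k * (F k.+1 - F k) =
  \sum_(k < n) (Y k - Y k.+1) * F k.+1 + Y n * F n - Y 0 * F 0.
Proof.
elim: n => [|n IHn]; first by rewrite !big_ord0; ring.
by rewrite !big_ord_recr /= IHn; ring.
Qed.

(** The prefixes of sigma climb from the empty set to the whole ground set, and the
    coordinates of the vertex are the successive increments. *)
Lemma sum_vertex {R : realType} {n : nat} (f : {set 'I_n} -> R)
    (sigma : {perm 'I_n}) :
  \sum_j vertex f sigma 0 j = f [set: 'I_n]%SET - f finset.set0.
Proof.
rewrite (reindex_inj (@perm_inj _ sigma)) /=.
under eq_bigr do rewrite vertex_at.
rewrite -(chain_full sigma) -(chain0 sigma).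
by rewrite -(telescope_sumr (fun k => f (chain sigma k)) (leq0n n)) big_mkord.
Qed.

(** A modular set function x(S) has a single greedy vertex, x itself.  This makes
    [chain_decomposition] say something about y alone: applied to x(S) it computes
    all linear functionals of y, hence y. *)
Lemma vertex_modular {R : realType} {n : nat} (x : 'rV[R]_n)
    (sigma : {perm 'I_n}) :
  vertex (fun S : {set 'I_n} => \sum_(j in S) x 0 j) sigma = x.
Proof.
apply/rowP => j; rewrite -(permKV sigma j) vertex_at chainS big_setU1 ?addrK //.
by rewrite mem_chain ltnn.
Qed.

(** Diminishing returns: inside S, the increment of f along the prefixes of sigma
    is at most the increment of f(S :&: _), and the latter increments add up to
    f(S). *)
Lemma vertex_in_base {R : realType} {n : nat} (f : {set 'I_n} -> R)
    (sigma : {perm 'I_n}) :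
  nondecreasing_setfun f -> submodular f -> f finset.set0 = 0 ->
  base_polyhedron f (vertex f sigma).
Proof.
move=> f_mono f_sub f0; split.
- move=> j; rewrite -(permKV sigma j) vertex_at subr_ge0 f_mono //.
  by rewrite chainS finset.subsetUr.
- move=> S.
  have -> : f S = \sum_j vertex (fun T => f (S :&: T)%SET) sigma 0 j.
    by rewrite sum_vertex finset.setIT finset.setI0 f0 subr0.
  rewrite [leLHS]big_mkcond; apply: ler_sum => j _.
  rewrite -(permKV sigma j); set k := (sigma^-1)%g j.
  rewrite !vertex_at chainS; case: ifPn => kS; last first.
    rewrite subr_ge0 f_mono //; apply: finset.setIS; exact: finset.subsetUr.
  (* Union and intersection of these two sets are the new prefix and the trace
     on S of the old one. *)
  have := f_sub (S :&: (sigma k |: chain sigma k))%SET (chain sigma k).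
  rewrite [X in f X + _](_ : _ = (sigma k |: chain sigma k)%SET); last first.
    apply/setP => i; rewrite !inE; case: eqVneq => [->|_] /=.
      by rewrite kS.
    by case: (i \in chain _ _); rewrite ?andbT ?andbF ?orbT.
  rewrite [X in _ + f X <= _](_ : _ = S :&: chain sigma k)%SET; last first.
    by rewrite -finset.setIA (finset.setIidPr (finset.subsetUr _ _)).
  lra.
- by rewrite sum_vertex f0 subr0.
Qed.

Lemma sorting_perm {R : realType} {n : nat} (y : 'rV[R]_n) :
  exists sigma : {perm 'I_n},
    forall i j : 'I_n, (i <= j)%N -> y 0 (sigma j) <= y 0 (sigma i).
Proof.
pose r := relpre (y 0) >=%O.
have r_trans : transitive r by move=> a b c; rewrite /r /=; lra.
have r_total : total r by move=> a b; exact: le_total.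
have r_refl : reflexive r by move=> a; exact: lexx.
have /tuple_permP[sigma sE] : perm_eq (sort r (ord_tuple n)) (ord_tuple n).
  by rewrite perm_sort.
exists sigma => i j le_ij.
have s_nth (k : 'I_n) : nth i (sort r (ord_tuple n)) k = sigma k.
  by rewrite sE -(tnth_nth i [tuple _ | _ < n]) tnth_mktuple tnth_ord_tuple.
have := sorted_leq_nth r_trans r_refl i (sort_sorted r_total (ord_tuple n)).
move=> /(_ i j); rewrite !inE size_sort size_tuple !ltn_ord !s_nth.
by apply.
Qed.

(** The weights are the gaps between consecutive coordinates of y in decreasing
    order, the last gap being down to 0.  They depend on y only, so that the same
    chain and weights serve every set function g. *)
Lemma chain_decomposition {R : realType} {n : nat} (y : 'rV[R]_n) :
  (forall j, 0 <= y 0 j) ->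
  exists (sigma : {perm 'I_n}) (lam : 'I_n -> R),
    (forall k, 0 <= lam k) /\
    forall g : {set 'I_n} -> R, g finset.set0 = 0 ->
      dot (vertex g sigma) y = \sum_k lam k * g (chain sigma k.+1).
Proof.
move=> y_ge0; have [sigma y_sorted] := sorting_perm y.
(* The sorted coordinates, continued by 0 beyond the last one. *)
pose Y (k : nat) := oapp (fun i => y 0 (sigma i)) 0 (insub k).
have Y_ord (k : 'I_n) : Y k = y 0 (sigma k) by rewrite /Y valK.
have Y_end k : (n <= k)%N -> Y k = 0.
  by move=> nk; rewrite /Y insubF // ltnNge nk.
exists sigma, (fun k => Y k - Y k.+1); split.
- move=> k; rewrite subr_ge0 Y_ord; case: (ltnP k.+1 n) => [kn|/Y_end -> //].
  by rewrite (Y_ord (Ordinal kn)) y_sorted.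
- move=> g g0; rewrite /dot (reindex_inj (@perm_inj _ sigma)) /=.
  under eq_bigr do rewrite vertex_at -Y_ord mulrC.
  rewrite (summation_by_parts Y (fun k => g (chain sigma k))).
  by rewrite Y_end // chain0 g0 mul0r mulr0 addr0 subr0.
Qed.

(** * Finite convex combinations *)

(** Points of weight zero need not lie in A, which lets the weights select the
    minimizers among the members of a chain. *)
Lemma convex_hull_sum {R : realType} {M : lmodType R} {I : finType}
    (A : set M) (a : I -> R) (p : I -> M) :
  (forall i, 0 <= a i) -> \sum_i a i = 1 -> (forall i, 0 < a i -> A (p i)) ->
  convex_hull A (\sum_i a i *: p i).
Proof.
move=> a_ge0 a_sum1 Ap C [C_convex AC].
(* Normalized partial sums stay in C; while the total weight is still 0 the
   point q is arbitrary. *)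
suff key (r : seq I) : exists2 q : M, (0 < \sum_(i <- r) a i -> C q) &
    \sum_(i <- r) a i *: p i = (\sum_(i <- r) a i) *: q.
  by have [q Cq ->] := key (index_enum I); rewrite a_sum1 scale1r;
    apply: Cq; rewrite a_sum1 ltr01.
elim: r => [|i r [q Cq q_eq]].
  by exists 0; rewrite !big_nil ?ltxx // scale0r.
rewrite !big_cons q_eq; set s := \sum_(j <- r) a j in Cq *.
have s_ge0 : 0 <= s by apply: sumr_ge0.
have [ai0|ai_neq0] := eqVneq (a i) 0.
  by exists q; rewrite ai0 ?add0r // scale0r add0r.
have ai_gt0 : 0 < a i by rewrite lt_def ai_neq0 a_ge0.
have [s0|s_neq0] := eqVneq s 0.
  exists (p i) => [_|]; first by apply: AC; apply: Ap.
  by rewrite s0 scale0r !addr0.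
have s_gt0 : 0 < s by rewrite lt_def s_neq0.
have t_ge0 : 0 <= a i / (a i + s) by rewrite divr_ge0 // addr_ge0.
have t_le1 : a i / (a i + s) <= 1.
  by rewrite ler_pdivrMr ?addr_gt0 // mul1r lerDl.
exists (a i / (a i + s) *: p i + (1 - a i / (a i + s)) *: q).
  move=> _; apply/set_mem; apply: (C_convex _ _ (Itv01 t_ge0 t_le1)).
  - by apply/mem_set/AC/Ap.
  - by apply/mem_set/Cq.
have as_neq0 : a i + s != 0 by rewrite gt_eqF // addr_gt0.
rewrite scalerDr !scalerA; congr (_ *: _ + _ *: _); by field.
Qed.

(** * Raising a dominated vector to the base polyhedron *)

Definition dominated {R : realType} {n : nat} (f : {set 'I_n} -> R)
    (x : 'rV[R]_n) : Prop :=
  forall S : {set 'I_n}, \sum_(j in S) x 0 j <= f S.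

Lemma setsum_modular {R : realType} {n : nat} (x : 'rV[R]_n)
    (S T : {set 'I_n}) :
  \sum_(j in S :|: T) x 0 j + \sum_(j in S :&: T) x 0 j =
  \sum_(j in S) x 0 j + \sum_(j in T) x 0 j.
Proof.
rewrite !(big_mkcond (fun j => j \in _)) -!big_split /=.
apply: eq_bigr => j _; rewrite !inE.
by case: (j \in S); case: (j \in T); rewrite /= ?addr0 ?add0r.
Qed.

(** For x below f, the slack f(S) - x(S) is submodular and nonnegative, so its
    zeros are closed under union. *)
Lemma tight_setU {R : realType} {n : nat} (f : {set 'I_n} -> R)
    (x : 'rV[R]_n) (S T : {set 'I_n}) :
  submodular f -> dominated f x ->
  \sum_(j in S) x 0 j = f S -> \sum_(j in T) x 0 j = f T ->
  \sum_(j in S :|: T) x 0 j = f (S :|: T)%SET.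
Proof.
move=> f_sub x_dom xS xT.
have := setsum_modular x S T; have := f_sub S T.
by have := x_dom (S :&: T)%SET; have := x_dom (S :|: T)%SET; lra.
Qed.

(** Pick a coordinate outside a tight set T and raise it until some set S0
    containing it becomes tight.  T stays tight, and the union of T and S0 is a
    strictly larger tight set; once the whole ground set is tight, the vector is
    in the base polyhedron. *)
Lemma base_extension {R : realType} {n : nat} (f : {set 'I_n} -> R)
    (x : 'rV[R]_n) :
  submodular f -> f finset.set0 = 0 ->
  (forall j, 0 <= x 0 j) -> dominated f x ->
  exists2 z, base_polyhedron f z & forall j, x 0 j <= z 0 j.
Proof.
move=> f_sub f0 x_ge0 x_dom.
suff grow (m : nat) (T : {set 'I_n}) (u : 'rV[R]_n) :
    (#|~: T| <= m)%N -> dominated f u -> \sum_(j in T) u 0 j = f T ->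
    exists z, [/\ dominated f z, \sum_j z 0 j = f [set: 'I_n]%SET &
                  forall j, u 0 j <= z 0 j].
  have [|z [z_dom z_tot xz]] := grow _ finset.set0 x (leqnn _) x_dom.
    by rewrite big_set0 f0.
  by exists z => //; split=> // j; apply: le_trans (xz j).
elim: m T u => [|m IHm] T u.
  rewrite leqn0 cards_eq0 => /eqP/(congr1 (@finset.setC _)).
  rewrite finset.setCK finset.setC0 => -> u_dom u_tot; exists u; split=> //.
  by rewrite -u_tot; apply: eq_bigl => j; rewrite inE.
move=> leTm u_dom uT; have [T_full|] := eqVneq T [set: 'I_n]%SET.
  exists u; split=> //.
  by rewrite -T_full -uT T_full; apply: eq_bigl => j; rewrite inE.
rewrite -finset.subTset => /subsetPn[j _ jT].
(* The smallest gap over the sets containing j is how far coordinate j can go. *)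
pose gap (S : {set 'I_n}) := f S - \sum_(i in S) u 0 i.
have [S0 jS0 gap_min] :=
  @arg_minP _ R _ [set: 'I_n]%SET (fun S => j \in S) gap (finset.in_setT j).
pose u' := u + gap S0 *: delta_mx 0 j.
have u'E (S : {set 'I_n}) :
    \sum_(i in S) u' 0 i = \sum_(i in S) u 0 i + gap S0 *+ (j \in S).
  under eq_bigr do rewrite !mxE eqxx /=.
  by rewrite big_split -mulr_sumr sum_indicator mulr_natr.
have u'_dom : dominated f u'.
  move=> S; rewrite u'E; case: (boolP (j \in S)) => jS.
    by have := gap_min S jS; rewrite /gap mulr1n; lra.
  by rewrite addr0.
have u'T : \sum_(i in T) u' 0 i = f T by rewrite u'E (negPf jT) addr0.
have u'S0 : \sum_(i in S0) u' 0 i = f S0.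
  by rewrite u'E jS0 mulr1n /gap addrC subrK.
have [|z [z_dom z_tot uz]] :=
  IHm _ u' _ u'_dom (tight_setU f_sub u'_dom u'T u'S0).
  rewrite -ltnS; apply: leq_trans leTm; apply: proper_card.
  rewrite finset.properC; apply/properP; split; first exact: finset.subsetUl.
  by exists j; rewrite // inE jS0 orbT.
exists z; split=> // i; apply: le_trans (uz i).
by rewrite !mxE lerDl mulr_ge0 ?ler0n // subr_ge0.
Qed.

(** * The game *)

Lemma player2_strategyP {R : realType} {n : nat} (w y : 'rV[R]_n) :
  (forall i, 0 < w 0 i) ->
  player2_strategy w y <->
  (forall j, 0 <= y 0 j) /\ \sum_j y 0 j / w 0 j = 1.
Proof.
move=> w_gt0; have coord (theta : 'I_n -> R) j :
    (\sum_i (theta i * w 0 i) *: delta_mx 0 i : 'rV[R]_n) 0 j = theta j * w 0 j.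
  rewrite summxE (bigD1 j) //= big1 ?addr0 => [|i /negPf ij].
    by rewrite !mxE !eqxx mulr1.
  by rewrite !mxE eq_sym ij andbF mulr0.
have w_neq0 j : w 0 j != 0 by rewrite gt_eqF.
split=> [[theta [theta_ge0 theta_sum ->]]|[y_ge0 y_sum]].
  split=> [j|]; first by rewrite coord mulr_ge0 // ltW.
  by rewrite -theta_sum; apply: eq_bigr => j _; rewrite coord mulfK.
exists (fun j => y 0 j / w 0 j); split=> // [j|].
  by rewrite divr_ge0 // ltW.
by apply/rowP => j; rewrite coord divfK.
Qed.

Lemma winv_gt0 {R : realType} {n : nat} (w : 'rV[R]_n) (S : {set 'I_n}) :
  (forall i, 0 < w 0 i) -> S != finset.set0 -> 0 < winv w S.
Proof.
move=> w_gt0 /set0Pn[j jS]; rewrite /winv (bigD1 j) //= ltr_pwDl ?invr_gt0 //.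
by apply: sumr_ge0 => i _; rewrite invr_ge0 ltW.
Qed.

Lemma ypoint_at {R : realType} {n : nat} (w : 'rV[R]_n) (S : {set 'I_n}) j :
  ypoint w S 0 j = (winv w S)^-1 * (j \in S)%:R.
Proof.
rewrite mxE summxE -sum_indicator; congr (_ * _); apply: eq_bigr => i _.
by rewrite mxE eqxx eq_sym.
Qed.

Lemma dot_ypoint {R : realType} {n : nat} (w x : 'rV[R]_n) (S : {set 'I_n}) :
  dot x (ypoint w S) = (winv w S)^-1 * \sum_(j in S) x 0 j.
Proof.
rewrite mulr_sumr [RHS]big_mkcond; apply: eq_bigr => j _; rewrite ypoint_at.
by case: ifP => _; rewrite ?mulr0 // mulr1 mulrC.
Qed.

Lemma ypoint_strategy {R : realType} {n : nat} (w : 'rV[R]_n)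
    (S : {set 'I_n}) :
  (forall i, 0 < w 0 i) -> S != finset.set0 -> player2_strategy w (ypoint w S).
Proof.
move=> w_gt0 S_neq0; have wS := winv_gt0 w_gt0 S_neq0.
apply/(player2_strategyP _ w_gt0); split=> [j|].
  by rewrite ypoint_at mulr_ge0 ?ler0n // invr_ge0 ltW.
rewrite -(mulVf (lt0r_neq0 wS)) {2}/winv mulr_sumr [RHS]big_mkcond.
apply: eq_bigr => j _; rewrite ypoint_at.
by case: ifP; rewrite ?mulr1 // mulr0 mul0r.
Qed.

Lemma min_family_inhabited {R : realType} {n : nat} (f : {set 'I_n} -> R)
    (w : 'rV[R]_n) :
  (0 < n)%N -> exists S, min_family f w S.
Proof.
move=> n_gt0.
have V_neq0 : [set: 'I_n]%SET != finset.set0.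
  by apply/set0Pn; exists (Ordinal n_gt0).
have [S S_neq0 S_min] :=
  @arg_minP _ R _ [set: 'I_n]%SET (fun S => S != finset.set0)
    (fun S => f S / winv w S) V_neq0.
by exists S.
Qed.

(** The minimal ratio v = min f(S) / w^-1(S), in division-free form: the
    inequality then also covers the empty set, and the minimizers are the sets
    where it is tight. *)
Definition is_min_ratio {R : realType} {n : nat} (f : {set 'I_n} -> R)
    (w : 'rV[R]_n) (v : R) : Prop :=
  (forall S, v * winv w S <= f S) /\
  forall S, S != finset.set0 -> min_family f w S <-> f S = v * winv w S.

Lemma min_ratioP {R : realType} {n : nat} (f : {set 'I_n} -> R)
    (w : 'rV[R]_n) (S : {set 'I_n}) :
  (forall i, 0 < w 0 i) -> f finset.set0 = 0 -> min_family f w S ->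
  is_min_ratio f w (f S / winv w S).
Proof.
move=> w_gt0 f0 [S_neq0 S_min]; split=> T.
  have [->|T_neq0] := eqVneq T finset.set0.
    by rewrite f0 /winv big_set0 mulr0.
  by rewrite -ler_pdivlMr ?winv_gt0 // S_min.
move=> T_neq0; have wT := winv_gt0 w_gt0 T_neq0; split=> [[_ T_min]|fT].
  have -> : f S / winv w S = f T / winv w T.
    by apply: le_anti; rewrite S_min // T_min.
  by rewrite divfK ?gt_eqF.
by split=> // U U_neq0; rewrite {1}fT mulfK ?gt_eqF // S_min.
Qed.

Section Game.
Context {R : realType} {n : nat} {f : {set 'I_n} -> R} {w : 'rV[R]_n} {v : R}.
Hypothesis n_gt0 : (0 < n)%N.
Hypothesis f_ge0 : forall S : {set 'I_n}, 0 <= f S.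
Hypothesis f_nondecreasing : nondecreasing_setfun f.
Hypothesis f_submodular : submodular f.
Hypothesis f_set0 : f finset.set0 = 0.
Hypothesis w_gt0 : forall i : 'I_n, 0 < w 0 i.
Hypothesis v_ratio : is_min_ratio f w v.

Lemma ypoint_payoff_le (x : 'rV[R]_n) (S : {set 'I_n}) :
  base_polyhedron f x -> min_family f w S -> dot x (ypoint w S) <= v.
Proof.
move=> [_ x_dom _] S_min; have S_neq0 := S_min.1.
have fS := (v_ratio.2 _ S_neq0).1 S_min.
rewrite dot_ypoint mulrC ler_pdivrMr ?winv_gt0 // -fS; exact: x_dom.
Qed.

(** The chain decomposition renormalized by w^-1; the three identities come from
    applying [chain_decomposition] to w^-1 (total weight), to the indicators of
    membership of each j (coordinates of y) and to f (payoff). *)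
Lemma chain_weights (y : 'rV[R]_n) : player2_strategy w y ->
  exists (sigma : {perm 'I_n}) (mu : 'I_n -> R),
    [/\ forall k, 0 <= mu k, \sum_k mu k = 1,
        y = \sum_k mu k *: ypoint w (chain sigma k.+1)
      & dot (vertex f sigma) y =
        \sum_k mu k * (f (chain sigma k.+1) / winv w (chain sigma k.+1))].
Proof.
move=> /(player2_strategyP _ w_gt0)[y_ge0 y_sum].
have [sigma [lam [lam_ge0 dotE]]] := chain_decomposition y_ge0.
have chain_w k := winv_gt0 w_gt0 (chain_neq0 sigma k).
have dot_modular (x : 'rV[R]_n) :
    dot x y = \sum_k lam k * \sum_(j in chain sigma k.+1) x 0 j.
  rewrite -(dotE (fun S => \sum_(j in S) x 0 j)) ?vertex_modular //.
  by rewrite big_set0.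
exists sigma, (fun k => lam k * winv w (chain sigma k.+1)); split.
- by move=> k; rewrite mulr_ge0 // ltW.
- have := dot_modular (\row_j (w 0 j)^-1); rewrite /dot.
  under eq_bigr do rewrite mxE mulrC.
  rewrite y_sum => ->; apply: eq_bigr => k _; congr (_ * _).
  by apply: eq_bigr => j _; rewrite mxE.
- apply/rowP => j; have := dot_modular (delta_mx 0 j).
  rewrite /dot (bigD1 j) //=.
  rewrite big1 ?addr0 => [|i /negPf ij]; last by rewrite !mxE ij mul0r.
  rewrite !mxE !eqxx mul1r summxE => ->; apply: eq_bigr => k _.
  rewrite mxE ypoint_at mulrA mulfK ?gt_eqF //; congr (_ * _).
  by rewrite -sum_indicator; apply: eq_bigr => i _; rewrite mxE eqxx.
- rewrite dotE //; apply: eq_bigr => k _.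
  by rewrite -mulrA [winv _ _ * _]mulrC divfK ?gt_eqF.
Qed.

Lemma ratio_ge (S : {set 'I_n}) : S != finset.set0 -> v <= f S / winv w S.
Proof. by move=> S_neq0; rewrite ler_pdivlMr ?winv_gt0 // v_ratio.1. Qed.

Lemma strategy_payoff_ge (y : 'rV[R]_n) : player2_strategy w y ->
  exists sigma, v <= dot (vertex f sigma) y.
Proof.
move=> /chain_weights[sigma [mu [mu_ge0 mu_sum _ dotE]]]; exists sigma.
rewrite dotE -[leLHS]mul1r -mu_sum mulr_suml; apply: ler_sum => k _.
by rewrite ler_wpM2l // ratio_ge // chain_neq0.
Qed.

(** An average of ratios that are all at least v can only be at most v if each
    ratio of positive weight equals v. *)
Lemma tight_strategy_in_hull (y : 'rV[R]_n) : player2_strategy w y ->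
  (forall sigma, dot (vertex f sigma) y <= v) ->
  convex_hull [set ypoint w S | S in min_family f w] y.
Proof.
move=> /chain_weights[sigma [mu [mu_ge0 mu_sum -> dotE]]] /(_ sigma).
rewrite dotE => y_le; apply: convex_hull_sum => // k mu_gt0.
exists (chain sigma k.+1) => //.
apply/(v_ratio.2 _ (chain_neq0 sigma k)).
pose excess j := mu j * (f (chain sigma j.+1) / winv w (chain sigma j.+1) - v).
have excess_ge0 j : 0 <= excess j.
  by rewrite mulr_ge0 // subr_ge0 ratio_ge // chain_neq0.
have excess_sum : \sum_j excess j <= 0.
  rewrite /excess; under eq_bigr do rewrite mulrBr.
  by rewrite sumrB -mulr_suml mu_sum mul1r subr_le0.
have : \sum_j excess j = 0 by apply: le_anti; rewrite excess_sum sumr_ge0.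
move=> /(psumr_eq0P (fun i _ => excess_ge0 i))/(_ k isT)/eqP.
rewrite mulf_eq0 gt_eqF //= subr_eq0 => /eqP <-.
by rewrite divfK // gt_eqF // winv_gt0 // chain_neq0.
Qed.

Lemma hull_payoff_le (x y : 'rV[R]_n) : base_polyhedron f x ->
  convex_hull [set ypoint w S | S in min_family f w] y -> dot x y <= v.
Proof.
move=> xB /(_ [set z | dot x z <= v]); apply; split; last first.
  by move=> _ [S S_min <-]; exact: ypoint_payoff_le.
move=> a b t /set_mem /= a_le /set_mem /= b_le; apply/mem_set => /=.
have -> : dot x (conv t (a : convex_lmodType _) b) =
    t%:num * dot x a + (1 - t%:num) * dot x b.
  change (conv t (a : convex_lmodType _) b)
    with (t%:num *: a + (1 - t%:num) *: b).
  rewrite /dot !mulr_sumr -big_split; apply: eq_bigr => j _ /=.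
  by rewrite !mxE; ring.
have : 0 <= t%:num by [].
have : t%:num <= 1 by [].
nra.
Qed.

(** Player 1 secures v with a base above (v / w_j)_j and no more than v because of
    a minimizer S0, on which x(S0) <= f(S0) = v w^-1(S0); Player 2 concedes only v
    with y^(S0), and at least v by [strategy_payoff_ge]. *)
Lemma min_ratio_is_value : game_value f w v.
Proof.
have [S0 S0_min] := min_family_inhabited f w n_gt0.
have S0_neq0 := S0_min.1; have fS0 := (v_ratio.2 _ S0_neq0).1 S0_min.
have wS0 := winv_gt0 w_gt0 S0_neq0.
have v_ge0 : 0 <= v by rewrite -(pmulr_lge0 v wS0) -fS0.
have security x m : base_polyhedron f x ->
    (forall j, m <= w 0 j * x 0 j) -> m <= v.
  move=> [_ x_dom _] m_le; rewrite -(ler_pM2r wS0) -fS0.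
  apply: le_trans (x_dom S0); rewrite /winv mulr_sumr; apply: ler_sum => j _.
  by rewrite ler_pdivrMr // mulrC.
split; split.
- pose x := \row_j (v / w 0 j).
  have [j|S|z zB xz] := @base_extension R n f x f_submodular f_set0.
  + by rewrite mxE divr_ge0 // ltW.
  + apply: le_trans (v_ratio.1 S); rewrite /winv mulr_sumr.
    by under eq_bigr do rewrite mxE.
  exists z => //.
  have v_le j : v <= w 0 j * z 0 j.
    by have := xz j; rewrite mxE ler_pdivrMr // mulrC.
  have [j _ j_min] := @arg_minP _ R _ (Ordinal n_gt0) xpredT
    (fun j => w 0 j * z 0 j) isT.
  split; last by move=> _ [i _ <-].
  exists j => //=; apply: le_anti; rewrite v_le andbT.
  by apply: security zB _ => i; apply: j_min.
- move=> m [x xB [_ m_le]]; apply: security xB _ => j; apply: m_le.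
  by exists j.
- exists (ypoint w S0); first exact: ypoint_strategy.
  have ub sigma : dot (vertex f sigma) (ypoint w S0) <= v.
    by apply: ypoint_payoff_le => //; exact: vertex_in_base.
  split; last by move=> _ [sigma _ <-].
  have [sigma v_le] := strategy_payoff_ge (ypoint_strategy w_gt0 S0_neq0).
  by exists sigma => //; apply: le_anti; rewrite ub v_le.
- move=> m [y y_strategy [_ m_ge]].
  have [sigma v_le] := strategy_payoff_ge y_strategy.
  by apply: le_trans v_le _; apply: m_ge; exists sigma.
Qed.

Lemma game_value_unique (u : R) : game_value f w u -> u = v.
Proof.
move=> [[u_in u_ub] _]; have [[v_in v_ub] _] := min_ratio_is_value.
by apply: le_anti; rewrite v_ub // u_ub.
Qed.

End Game.

Unset Implicit Arguments.
Set Strict Implicit.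

Theorem theorem5 (R : realType) (n : nat) (n_gt0 : (0 < n)%N)
  (f : {set 'I_n} -> R) (f_ge0 : forall S : {set 'I_n}, 0 <= f S)
  (f_nondecreasing : nondecreasing_setfun f) (f_submodular : submodular f)
  (f_set0 : f finset.set0 = 0)
  (w : 'rV[R]_n) (w_gt0 : forall i : 'I_n, 0 < w 0 i)
  (y : 'rV[R]_n) (y_strategy : player2_strategy w y) :
  optimal2 f w y <-> convex_hull [set ypoint w S | S in min_family f w] y.
Proof.
have [S S_min] := min_family_inhabited f w n_gt0.
have v_ratio := min_ratioP w_gt0 f_set0 S_min.
have vertexB sigma : base_polyhedron f (vertex f sigma).
  exact: vertex_in_base.
split=> [[u u_value [_ u_ub]]|y_hull].
  have u_eq := game_value_unique n_gt0 f_ge0 f_nondecreasing f_submodular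
    f_set0 w_gt0 v_ratio u_value.
  apply: (tight_strategy_in_hull f_set0 w_gt0 v_ratio y_strategy) => sigma.
  by rewrite -u_eq; apply: u_ub; exists (vertex f sigma).
exists (f S / winv w S); first exact: min_ratio_is_value.
have ub x : base_polyhedron f x -> dot x y <= f S / winv w S.
  by move=> xB; exact: (hull_payoff_le w_gt0 v_ratio xB y_hull).
split; last by move=> _ [x xB <-]; exact: ub.
have [sigma v_le] := strategy_payoff_ge f_set0 w_gt0 v_ratio y_strategy.
by exists (vertex f sigma) => //; apply: le_anti; rewrite ub.
Qed.
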